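(* Let $B\subset \mathbb{N}$ be any finite set. Then there exists a hypergraph $\mathcal{H}=(X,\mathcal{F})$ such that, for every integer $b\geq 1$, Maker wins the $(b:b)$ Maker-Breaker game on $\mathcal{H}$ (with Maker as the first player) if and only if $b\notin B$.
   Context: For a hypergraph $\mathcal{H}=(X,\mathcal{F})$ and integers $m,b\geq 1$, the $(m:b)$ Maker-Breaker game on $\mathcal{H}$ is played as follows: Maker and Breaker alternate in moves; in each of her moves Maker claims up to $m$ previously unclaimed elements of the board $X$, and in each of his moves Breaker claims up to $b$ unclaimed elements of $X$. Maker wins if she claims all elements of some hyperedge $F\in\mathcal{F}$ (a winning set); otherwise Breaker wins. ''Maker wins'' means Maker has a winning strategy. *)

(* Defs.v *)
From mathcomp Require Import all_boot.

Set Implicit Arguments.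
Unset Strict Implicit.
Unset Printing Implicit Defensive.

Record hypergraph := Hypergraph {
  board : finType;
  hyperedges : {set {set board}}
}.

Section MakerBreaker.
Variables (H : hypergraph) (m b : nat).
Local Notation X := (board H).

(* [p t] is the set claimed in the [t]-th move.  Maker is the first player, so *)
(* she moves at the even times and Breaker at the odd ones.  Empty moves are   *)
(* allowed ("up to" [k] elements), so a play is an infinite sequence: once the *)
(* board is exhausted, every further move is empty.                            *)
Definition play := nat -> {set X}.

Definition legal_move (k : nat) (p : play) (t : nat) : Prop :=
  #|p t| <= k /\ [disjoint p t & \bigcup_(s < t) p s].

Definition maker_legal (p : play) : Prop :=
  forall t, ~~ odd t -> legal_move m p t.

Definition breaker_legal (p : play) : Prop :=
  forall t, odd t -> legal_move b p t.

Definition maker_claimed (p : play) (t : nat) : {set X} :=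
  \bigcup_(s < t | ~~ odd s) p s.

Definition maker_wins_play (p : play) : Prop :=
  exists t, exists2 F, F \in hyperedges H & F \subset maker_claimed p t.

(* A strategy maps the list of all moves made so far, in order, to a move. *)
Definition strategy := seq {set X} -> {set X}.

Definition follows (sigma : strategy) (p : play) : Prop :=
  forall t, ~~ odd t -> p t = sigma (mkseq p t).

Definition winning_strategy (sigma : strategy) : Prop :=
  forall p, follows sigma p -> breaker_legal p ->
    maker_legal p /\ maker_wins_play p.

Definition maker_wins : Prop := exists sigma, winning_strategy sigma.

End MakerBreaker.

(* Main.v *)
(** Take disjoint boxes, the winning sets being the sets that meet every box.
If at most [b] boxes have size at most [b], Maker first claims an element of
each of them; later she answers in the boxes that Breaker has just touched,
which had more than [b] free elements and hence still have one.  If more than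
[b] boxes have size at most [b], Maker's first move misses one of them, and
Breaker claims it entirely.  So Maker wins if and only if the number of boxes
of size at most [b] is at most [b].  With one box for each [i < n], where [n]
exceeds every element of [B], of size [i] if [i > 0] is in [B] and [i + 1]
otherwise, this number is [b + 1] if [b] is in [B], and at most [b] if not. *)

Require Import Defs.
From mathcomp Require Import all_boot finmap.

Set Implicit Arguments.
Unset Strict Implicit.
Unset Printing Implicit Defensive.

(** * Plays against a Breaker whose moves are fixed in advance *)

Section Plays.
Variables (H : hypergraph) (sigma : strategy H) (beta : nat -> {set board H}).
Implicit Type p : play H.

Definition claimed p t : {set board H} := \bigcup_(s < t) p s.

Lemma claimedS p t : claimed p t.+1 = claimed p t :|: p t.
Proof. by rewrite /claimed big_ord_recr. Qed.

Lemma maker_claimedS p t :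
  maker_claimed p t.+1 = maker_claimed p t :|: (if odd t then set0 else p t).
Proof.
by rewrite /maker_claimed big_mkcond big_ord_recr -big_mkcond /=; case: odd.
Qed.

(** A move of [sigma] depends on the whole prefix of the play, so the prefixes are built by
    recursion and the play is read off from them. *)
Fixpoint history t : seq {set board H} :=
  if t is u.+1
  then rcons (history u) (if odd u then beta u else sigma (history u))
  else [::].

Definition response_play : play H :=
  fun t => if odd t then beta t else sigma (history t).

Lemma mkseq_response_play t : mkseq response_play t = history t.
Proof. by elim: t => // t IH; rewrite mkseqS IH. Qed.

Lemma follows_response_play : follows sigma response_play.
Proof.
by move=> t /negPf t_even; rewrite mkseq_response_play /response_play t_even.
Qed.

End Plays.

(** * The game of meeting every box *)

Section TransversalGame.
Variables (X I : finType) (f : X -> I) (b : nat).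

Definition box i : {set X} := [set x | f x == i].

(** The boxes are the fibres of [f], so a set meets all of them exactly when its image under [f] is
    full. *)
Definition transversal_game : hypergraph :=
  Hypergraph [set F : {set X} | f @: F == setT].

Lemma maker_wins_transversal_few_small_boxes :
  maker_wins transversal_game b b -> #|[set i | #|box i| <= b]| <= b.
Proof.
case=> sigma win; rewrite leqNgt; apply/negP => many.
(* A winning strategy moves legally only in plays with a legal Breaker; an idle Breaker provides
   one. *)
have first_le : #|sigma [::]| <= b.
  pose p := response_play (H := transversal_game) sigma (fun=> set0).
  have [|/(_ 0 isT)[]] // := win p (follows_response_play _ _).
  move=> t t_odd; rewrite /legal_move /p /response_play t_odd.
  by rewrite cards0 disjoints_subset sub0set.
have [i small_i missed] :
    exists2 i, #|box i| <= b & i \notin f @: sigma [::].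
  have /subsetPn[i] : ~~ ([set i | #|box i| <= b] \subset f @: sigma [::]).
    apply: contraL many => /subset_leq_card le; rewrite -leqNgt.
    exact: leq_trans le (leq_trans (leq_imset_card _ _) first_le).
  by rewrite inE => ? ?; exists i.
pose p := response_play (H := transversal_game) sigma
  (fun t => if t == 1 then box i else set0).
have p0 : p 0 = sigma [::] by [].
have p1 : p 1 = box i by [].
have box_p0 : [disjoint box i & p 0].
  rewrite p0 disjoints_subset; apply/subsetP => x; rewrite !inE => /eqP fx.
  by apply: contra missed => x0; rewrite -fx imset_f.
have p_odd t : odd t -> p t = if t == 1 then box i else set0.
  by rewrite /p /response_play => ->.
have [|legal [t [F]]] := win p (follows_response_play _ _).
  move=> t t_odd; rewrite /legal_move p_odd //; case: eqP => [->|_].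
    by rewrite big_ord_recl big_ord0 setU0.
  by rewrite cards0 disjoints_subset sub0set.
rewrite inE => /eqP F_full /subsetP F_sub.
have /imsetP[x xF iE] : i \in f @: F by rewrite F_full inE.
have x_box : x \in box i by rewrite inE iE.
have /bigcupP[s s_even xs] := F_sub x xF.
(* Maker's element [x] of box [i] is not in her first move, which missed the box, nor in a later
   one, since Breaker took the box at time 1. *)
have [s0|s_gt0] := posnP s.
  by move: xs; rewrite s0 (disjointFr box_p0 x_box).
have [_ disj] := legal s s_even.
suff : x \in \bigcup_(r < s) p r by rewrite (disjointFr disj xs).
have s_gt1 : 1 < s by case: (nat_of_ord s) s_even s_gt0 => [|[|m]].
by apply/bigcupP; exists (Ordinal s_gt1); rewrite //= p1.
Qed.

Hypotheses (b_gt0 : 0 < b) (f_surj : f @: setT = setT).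

Section Strategy.
Variables A M : {set X}.

(** Here [A] stands for all claimed elements and [M] for those of Maker. *)
Definition untouched : {set I} := ~: (f @: M).

Definition free i : {set X} := box i :\: A.

Definition endangered : {set I} := [set i in untouched | #|free i| <= b].

(* The second case only guarantees progress against an idle Breaker. *)
Definition target : {set I} :=
  if endangered != set0 then endangered
  else if [pick i in untouched] is Some i then [set i] else set0.

(** [pick] depends only on the box, so each target box contributes at most one element. *)
Definition response : {set X} :=
  [set x | (f x \in target) && ([pick y in free (f x)] == Some x)].

Lemma target_sub : target \subset untouched.
Proof.
rewrite /target; case: ifP => _.
  by apply/subsetP => i; rewrite inE => /andP[].
by case: pickP => [i iU|_]; rewrite ?sub1set ?sub0set.
Qed.

Lemma endangered_sub_target : endangered \subset target.
Proof. by rewrite /target; case: eqP => [->|_]; rewrite ?sub0set. Qed.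

Lemma card_target : #|endangered| <= b -> #|target| <= b.
Proof.
rewrite /target; case: ifP => // _ _.
by case: pickP => [i _|_]; rewrite ?cards1 ?cards0.
Qed.

Lemma target_neq0 : untouched != set0 -> target != set0.
Proof.
rewrite /target; case: ifP => // _ /set0Pn[i iU].
case: pickP => [j _|/(_ i)]; last by rewrite iU.
by apply/set0Pn; exists j; rewrite set11.
Qed.

Lemma response_free : [disjoint response & A].
Proof.
rewrite disjoints_subset; apply/subsetP => x; rewrite !inE => /andP[_].
by case: pickP => // y + /eqP[<-]; rewrite !inE => /andP[].
Qed.

Lemma card_response : #|response| <= #|target|.
Proof.
have f_inj : {in response &, injective f}.
  move=> x y; rewrite !inE => /andP[_ /eqP xE] /andP[_ /eqP yE] fxy.
  by move: yE; rewrite -fxy xE => -[].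
rewrite -(card_in_imset f_inj); apply: subset_leq_card.
by apply/subsetP => _ /imsetP[x + ->]; rewrite inE => /andP[].
Qed.

Lemma imset_response :
  {in untouched, forall i, free i != set0} -> f @: response = target.
Proof.
move=> has_free; apply/setP => i; apply/imsetP/idP => [[x]|iT].
  by rewrite inE => /andP[? _] ->.
have /set0Pn[y yi] := has_free i (subsetP target_sub i iT).
case pickE: [pick z in free i] => [x|]; last first.
  by move: pickE; case: pickP => // /(_ y); rewrite yi.
have fx : f x = i.
  by move: pickE; case: pickP => // z + [<-]; rewrite !inE => /andP[_ /eqP].
by exists x; rewrite ?inE fx ?iT ?pickE ?eqxx.
Qed.

End Strategy.

Definition transversal_strategy : strategy transversal_game :=
  fun h => response (claimed (H := transversal_game) (nth set0 h) (size h))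
    (maker_claimed (H := transversal_game) (nth set0 h) (size h)).

Lemma transversal_strategy_mkseq (p : play transversal_game) t :
  transversal_strategy (mkseq p t) = response (claimed p t) (maker_claimed p t).
Proof.
rewrite /transversal_strategy size_mkseq /claimed /maker_claimed.
by congr response; apply: eq_bigr => s _; rewrite nth_mkseq.
Qed.

(* Maker's position before her [(k+1)]-st move. *)
Definition safe (A M : {set X}) k : Prop :=
  [/\ {in untouched M, forall i, free A i != set0}, #|endangered A M| <= b
    & #|untouched M| <= #|I| - k].

Lemma safe_response (A M N : {set X}) k : #|N| <= b -> safe A M k ->
  safe (A :|: response A M :|: N) (M :|: response A M) k.+1.
Proof.
move=> N_le [has_free endangered_le untouched_le].
have imR := imset_response has_free.
have untouchedE : untouched (M :|: response A M) = untouched M :\: target A M.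
  by rewrite /untouched imsetU imR setCU setDE.
(* A box still untouched was not a target: it was not endangered, and the response took nothing from
   it. *)
have freeE i : i \in untouched (M :|: response A M) ->
    free (A :|: response A M :|: N) i = free A i :\: N /\ b < #|free A i|.
  rewrite untouchedE inE => /andP[iNT iU]; split; last first.
    rewrite ltnNge; apply: contra iNT => le_b.
    by apply: (subsetP (endangered_sub_target A M)); rewrite inE iU.
  apply/setP => x; rewrite !in_setD !in_setU !negb_or.
  case: (boolP (x \in response A M)) => [xR|_]; last first.
    by rewrite andbT andbCA andbA.
  rewrite andbF /=; case: (boolP (x \in box i)) => [|_]; last by rewrite !andbF.
  by rewrite inE => /eqP fx; case/negP: iNT; rewrite -imR -fx imset_f.
split.
- move=> i /freeE[-> lt_b]; rewrite -card_gt0 cardsD subn_gt0.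
  apply: leq_ltn_trans lt_b; apply: leq_trans N_le.
  exact: subset_leq_card (subsetIr _ _).
(* Such a box had more than [b] free elements, so it is endangered now only if [N] meets it. *)
- apply: leq_trans N_le; apply: leq_trans (leq_imset_card f _).
  apply: subset_leq_card; apply/subsetP => i.
  rewrite inE => /andP[/freeE[-> lt_b]]; apply: contraTT => iN.
  rewrite -ltnNge (_ : free A i :\: N = free A i) //.
  apply/setP => x; rewrite !inE; case: (boolP (x \in N)) => // xN.
  case: eqP => [fx|_]; last by rewrite andbF.
  by case/negP: iN; rewrite -fx imset_f.
- rewrite untouchedE cardsD (setIidPr (target_sub A M)).
  have [U0|U_neq0] := eqVneq (untouched M) set0; first by rewrite U0 cards0.
  have : 0 < #|target A M| by rewrite card_gt0 target_neq0.
  by move=> T_gt0; rewrite subnS -subn1; apply: leq_sub.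
Qed.

Lemma few_small_boxes_maker_wins_transversal :
  #|[set i | #|box i| <= b]| <= b -> maker_wins transversal_game b b.
Proof.
move=> few; exists transversal_strategy => p foll legalB.
have pE t : ~~ odd t -> p t = response (claimed p t) (maker_claimed p t).
  by move=> t_even; rewrite foll // transversal_strategy_mkseq.
have safe_p k : safe (claimed p k.*2) (maker_claimed p k.*2) k.
  elim: k => [|k IH].
    rewrite /claimed /maker_claimed !big_ord0; split.
    - move=> i _; have /imsetP[x _ iE] : i \in f @: setT by rewrite f_surj inE.
      by apply/set0Pn; exists x; rewrite !inE iE eqxx.
    - apply: leq_trans few; apply/subset_leq_card/subsetP => i.
      by rewrite !inE /free setD0 => /andP[].
    - by rewrite subn0 max_card.
  rewrite doubleS !claimedS !maker_claimedS /= odd_double /= setU0.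
  rewrite pE ?odd_double //.
  apply: safe_response IH.
  by have [|] := legalB k.*2.+1; rewrite //= odd_double.
split=> [t t_even|].
  have [_ + _] := safe_p t./2; rewrite (even_halfK t_even) => endangered_le.
  rewrite /legal_move pE //; split; last exact: response_free.
  exact: leq_trans (card_response _ _) (card_target endangered_le).
(* Each round touches a new box while one is left, so [#|I|] rounds suffice. *)
exists #|I|.*2, (maker_claimed p #|I|.*2); last exact: subxx.
have [_ _] := safe_p #|I|; rewrite subnn leqn0 cards_eq0 /untouched => /eqP U0.
by rewrite inE -[f @: _]setCK U0 setC0.
Qed.

End TransversalGame.

Theorem theorem1p1 (B : {fset nat}) :
  exists H : hypergraph,
    forall b : nat, 1 <= b -> (maker_wins H b b <-> b \notin B).
Proof.
have [n B_lt] : exists n, forall b, b \in B -> b < n.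
  exists (\max_(b <- B) b).+1 => b bB.
  by rewrite ltnS; apply: leq_bigmax_seq.
(* Excluding 0 keeps every box nonempty, as [f_surj] demands. *)
pose inB i := (i \in B) && (0 < i).
pose a i := if inB i then i else i.+1.
have a_gt0 i : 0 < a i.
  by rewrite /a /inB; case: i => [|i]; rewrite ?andbF //; case: ifP.
pose f (x : {i : 'I_n & 'I_(a i)}) := tag x.
exists (transversal_game f) => b b_gt0.
have card_box i : #|box f i| = a i.
  have tag_inj := @eq_from_Tagged _ (fun j : 'I_n => 'I_(a j)) i.
  rewrite -[RHS]card_ord -(card_imset _ tag_inj).
  apply: eq_card => -[j x]; rewrite !inE; apply/eqP/imsetP => [<-|[y _ [] //]].
  by exists x.
have f_surj : f @: setT = setT.
  apply/setP => i; rewrite inE; apply/imsetP.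
  by exists (Tagged (fun i : 'I_n => 'I_(a i)) (Ordinal (a_gt0 i))).
(* Both [i] and [i.+1] are at most [b] if [i < b], and neither is if [i > b]; membership in [B]
   matters only at [i = b]. *)
have small : [set i | #|box f i| <= b] = [set i : 'I_n | i < b + (b \in B)].
  apply/setP => i; rewrite !inE card_box /a /inB.
  have [->|i_neq] := eqVneq (i : nat) b.
    by rewrite b_gt0 andbT; case: (b \in B); rewrite ?addn1 ?addn0 ?ltnn ?leqnn.
  have -> : (i < b + (b \in B)) = (i < b).
    by case: (b \in B); rewrite ?addn0 // addn1 ltnS leq_eqVlt (negPf i_neq).
  by case: ifP => // _; rewrite leq_eqVlt (negPf i_neq).
have card_lt m : m <= n -> #|[set i : 'I_n | i < m]| = m.
  move=> le_mn; rewrite -sum1dep_card -(big_mkord (fun i => i < m) (fun=> 1)).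
  by rewrite -(big_nat_widen _ _ _ xpredT) // sum_nat_const_nat subn0 muln1.
split=> [/maker_wins_transversal_few_small_boxes|bNB].
  rewrite small; apply: contraTN => bB.
  by rewrite bB addn1 card_lt ?ltnn ?B_lt.
apply: few_small_boxes_maker_wins_transversal => //.
(* If [b] exceeds [n], there are too few boxes in all to exceed [b]. *)
rewrite small (negPf bNB) addn0; have [le_bn|/ltnW le_nb] := leqP b n.
  by rewrite card_lt.
by apply: leq_trans le_nb; rewrite -[n in _ <= n]card_ord max_card.
Qed.
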